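(* Suppose $\mathcal{H}$ is a hereditary $3$-graph property and $\mathcal{B}_{\mathcal{H}}$ contains infinitely many pairwise non-isomorphic $3$-graphs. Then there is $C>0$ such that $\epsilon^{-C}\leq M_{\mathcal{H}}(\epsilon)$ for all sufficiently small $\epsilon>0$; moreover, whenever $M^{hom}_{\mathcal H}$ is defined, $M_{\mathcal{H}}(\epsilon)\leq M^{hom}_{\mathcal{H}}(\epsilon^4)$.
   Context: $3$-graphs $H=(V,E)$, $E\subseteq\binom V3$; hereditary $3$-graph properties are classes of finite $3$-graphs closed under isomorphism and induced sub-$3$-graphs. $d_H(X,Y,Z)=|\{(x,y,z)\in X\times Y\times Z:\{x,y,z\}\in E\}|/(|X||Y||Z|)$. A triple is $\epsilon$-regular if $|d_H(X,Y,Z)-d_H(X',Y',Z')|\le\epsilon$ for all $X'\subseteq X,Y'\subseteq Y,Z'\subseteq Z$ of sizes at least $\epsilon|X|,\epsilon|Y|,\epsilon|Z|$; $\epsilon$-homogeneous if $d_H(X,Y,Z)\in[0,\epsilon)\cup(1-\epsilon,1]$. A partition $\mathcal P$ of $V$ is $\epsilon$-regular (resp. homogeneous) if at least $(1-\epsilon)|V|^3$ triples of $V^3$ lie in $X\times Y\times Z$ for an $\epsilon$-regular (resp. $\epsilon$-homogeneous) $(X,Y,Z)\in\mathcal P^3$. $M_{\mathcal H}(\epsilon)$ (resp. $M^{hom}_{\mathcal H}(\epsilon)$) is the least $M$ such that all sufficiently large members of $\mathcal H$ have an $\epsilon$-regular (resp. $\epsilon$-homogeneous) partition with at most $M$ parts;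 $M^{hom}_{\mathcal H}$ is defined if such $M$ exists for all $\epsilon$. For a $3$-graph $G=(V,E)$, $x\sim_G y$ means: for all $z_1,z_2\in V\setminus\{x,y\}$, $xz_1z_2\in E$ iff $yz_1z_2\in E$ (an equivalence relation); $G$ is irreducible if every $\sim_G$-class has size $1$ or $2$. For a $3$-graph $G=(U,E)$ and $n\ge1$, an $n$-blowup of $G$ is a $3$-graph with vertex set $\bigcup_{u\in U}V_u$, disjoint $|V_u|=n$, in which for distinct $u_1,u_2,u_3$ every triple $\{x_1,x_2,x_3\}$ with $x_i\in V_{u_i}$ is an edge if $u_1u_2u_3\in E$ and is a non-edge otherwise (triples meeting some $V_u$ twice are arbitrary). $\mathcal B_{\mathcal H}$ is the class of irreducible $3$-graphs $G$ such that for every $n\ge1$, some $n$-blowup of $G$ lies in $\mathcal H$. *)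

(* Defs.v *)
From HB Require Import structures.
From mathcomp Require Import all_boot all_order all_algebra.
From mathcomp Require Import reals exp.
Set Implicit Arguments. Unset Strict Implicit. Unset Printing Implicit Defensive.
Import Order.TTheory GRing.Theory Num.Theory.
Local Open Scope ring_scope.

Definition uniform3 (V : finType) (E : {set {set V}}) : bool :=
  [forall e in E, #|e| == 3%N].

Definition prop3 := forall V : finType, {set {set V}} -> Prop.

Definition img_edges (V W : finType) (g : V -> W) (E : {set {set V}})
  : {set {set W}} := [set g @: e | e : {set V} in E].

Definition induced (V : finType) (E : {set {set V}}) (S : {set V})
  : {set {set {x : V | x \in S}}} :=
  [set e : {set {x : V | x \in S}} | (#|e| == 3%N) && (val @: e \in E)].

Definition hereditary (H : prop3) : Prop :=
  [/\ (forall V E, H V E -> uniform3 E),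
      (forall (V W : finType) (g : V -> W) (E : {set {set V}}),
          bijective g -> H V E -> H W (img_edges g E))
    & (forall (V : finType) (E : {set {set V}}) (S : {set V}),
          H V E -> H _ (induced E S))].

Definition iso3 (V W : finType) (E : {set {set V}}) (F : {set {set W}}) : Prop :=
  exists g : V -> W, bijective g /\ forall e : {set V}, (g @: e \in F) = (e \in E).

Definition simG (V : finType) (E : {set {set V}}) (x y : V) : bool :=
  [forall z1 : V, forall z2 : V,
     ((z1 \notin [set x; y]) && (z2 \notin [set x; y])) ==>
     (([set x; z1; z2] \in E) == ([set y; z1; z2] \in E))].

Definition irreducible3 (V : finType) (E : {set {set V}}) : bool :=
  [forall x : V, (#|[set y | simG E x y]| == 1%N) || (#|[set y | simG E x y]| == 2%N)].

(* (W, F) is an n-blowup of (U, E): pi maps each vertex to the part V_u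
   containing it; all parts have size n; triples meeting three distinct parts
   are edges iff the corresponding triple of U is an edge. *)
Definition is_blowup (n : nat) (U : finType) (E : {set {set U}})
  (W : finType) (F : {set {set W}}) : Prop :=
  exists pi : W -> U,
    (forall u : U, #|[set x | pi x == u]| = n) /\
    (forall x1 x2 x3 : W,
        pi x1 != pi x2 -> pi x1 != pi x3 -> pi x2 != pi x3 ->
        ([set x1; x2; x3] \in F) = ([set pi x1; pi x2; pi x3] \in E)).

Definition inB (H : prop3) (U : finType) (E : {set {set U}}) : Prop :=
  [/\ uniform3 E, irreducible3 E &
      forall n : nat, (1 <= n)%N ->
        exists (W : finType) (F : {set {set W}}), is_blowup n E F /\ H W F].

Definition B_infinite (H : prop3) : Prop :=
  forall k : nat, exists (Vs : 'I_k -> finType) (Es : forall i, {set {set Vs i}}),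
    (forall i, inB H (Es i)) /\
    (forall i j : 'I_k, i != j -> ~ iso3 (Es i) (Es j)).

Section Regularity.
Variable R : realType.

(* d_H(X,Y,Z) (taken to be 0 if one of X, Y, Z is empty) *)
Definition density (V : finType) (E : {set {set V}}) (X Y Z : {set V}) : R :=
  (#|[set t in setX (setX X Y) Z | [set t.1.1; t.1.2; t.2] \in E]|%:R
     / (#|X| * #|Y| * #|Z|)%:R).

Definition eps_regular (V : finType) (E : {set {set V}}) (eps : R) (X Y Z : {set V})
  : bool :=
  [forall X' : {set V}, forall Y' : {set V}, forall Z' : {set V},
    [&& X' \subset X, Y' \subset Y, Z' \subset Z,
        eps * #|X|%:R <= #|X'|%:R, eps * #|Y|%:R <= #|Y'|%:R
      & eps * #|Z|%:R <= #|Z'|%:R] ==>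
    (`|density E X Y Z - density E X' Y' Z'| <= eps)].

Definition eps_homogeneous (V : finType) (E : {set {set V}}) (eps : R) (X Y Z : {set V})
  : bool :=
  (density E X Y Z < eps) || (1 - eps < density E X Y Z).

Definition good_partition (V : finType) (good : {set V} -> {set V} -> {set V} -> bool)
  (eps : R) (P : {set {set V}}) : bool :=
  partition P [set: V] &&
  ((1 - eps) * (#|V| ^ 3)%:R <=
   #|[set t : V * V * V | [exists X in P, exists Y in P, exists Z in P,
        [&& t.1.1 \in X, t.1.2 \in Y, t.2 \in Z & good X Y Z]]]|%:R).

Definition regular_partition (V : finType) (E : {set {set V}}) (eps : R) P :=
  good_partition (eps_regular E eps) eps P.

Definition homogeneous_partition (V : finType) (E : {set {set V}}) (eps : R) P :=
  good_partition (eps_homogeneous E eps) eps P.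

Definition reg_bound (H : prop3) (eps : R) (M : nat) : Prop :=
  exists N : nat, forall (V : finType) (E : {set {set V}}), H V E -> (N <= #|V|)%N ->
    exists P : {set {set V}}, regular_partition E eps P /\ (#|P| <= M)%N.

Definition hom_bound (H : prop3) (eps : R) (M : nat) : Prop :=
  exists N : nat, forall (V : finType) (E : {set {set V}}), H V E -> (N <= #|V|)%N ->
    exists P : {set {set V}}, homogeneous_partition E eps P /\ (#|P| <= M)%N.

Definition is_MH (H : prop3) (eps : R) (M : nat) : Prop :=
  reg_bound H eps M /\ forall M', reg_bound H eps M' -> (M <= M')%N.

Definition is_MHhom (H : prop3) (eps : R) (M : nat) : Prop :=
  hom_bound H eps M /\ forall M', hom_bound H eps M' -> (M <= M')%N.

Definition MHhom_defined (H : prop3) : Prop :=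
  forall eps : R, 0 < eps -> exists M, hom_bound H eps M.

End Regularity.

(* Main.v *)
(** An irreducible 3-graph on at least 2k vertices has a set A of k pairwise
inequivalent vertices, since classes have size at most 2.  Adding to A one pair
of vertices distinguishing each two members of A gives a set S with
|S| <= k + 2k^2.  By heredity, H contains n-blowups of the 3-graph induced on S
for all n.  If such a blowup had an eps-regular partition into M < k parts, each
V_u would have at least n/M vertices in a common part, so two vertices x, y of A
would share a part X.  For z1, z2 in S distinguishing x and y, the parts of z1
and z2 form with X a triple too large to be irregular when eps (M|S|)^3 < 1,
although the vertices of V_x and V_y in X produce densities 1 and 0.  As
(k|S|)^3 = O(k^9), one can take k of order eps^(-1/10).

For the second part, a density below eps^4 on a triple is at most
eps^4 / eps^3 = eps on any triple of subsets of relative sizes at least eps; for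
densities above 1 - eps^4 the same applies to the non-edges. *)
Require Import Defs.
From HB Require Import structures.
From mathcomp Require Import all_boot all_order all_algebra.
From mathcomp Require Import reals exp.
From mathcomp Require Import zify ring lra.
Set Implicit Arguments. Unset Strict Implicit. Unset Printing Implicit Defensive.
Import Order.TTheory GRing.Theory Num.Theory.
Local Open Scope ring_scope.

(** * Densities of triples, and regularity from homogeneity *)

Section Density.
Variables (R : realType) (V : finType) (E : {set {set V}}).
Implicit Types X Y Z : {set V}.

Definition edge_triples X Y Z : {set V * V * V} :=
  [set t in setX (setX X Y) Z | [set t.1.1; t.1.2; t.2] \in E].

Definition nonedge_triples X Y Z : {set V * V * V} :=
  [set t in setX (setX X Y) Z | [set t.1.1; t.1.2; t.2] \notin E].

Lemma card_edge_nonedge X Y Z :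
  (#|edge_triples X Y Z| + #|nonedge_triples X Y Z| = #|X| * #|Y| * #|Z|)%N.
Proof.
rewrite -!cardsX -(cardsID [set t | [set t.1.1; t.1.2; t.2] \in E] (setX _ Z)).
congr (_ + _)%N; apply: eq_card => t; rewrite !inE //.
by rewrite andbC.
Qed.

Lemma density_edge X Y Z :
  density R E X Y Z = #|edge_triples X Y Z|%:R / (#|X| * #|Y| * #|Z|)%:R.
Proof. by []. Qed.

Lemma density_nonedge X Y Z : (0 < #|X| * #|Y| * #|Z|)%N ->
  1 - density R E X Y Z = #|nonedge_triples X Y Z|%:R / (#|X| * #|Y| * #|Z|)%:R.
Proof.
move=> h; rewrite density_edge -card_edge_nonedge.
have : (#|edge_triples X Y Z| + #|nonedge_triples X Y Z|)%:R != 0 :> R.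
  by rewrite pnatr_eq0 card_edge_nonedge -lt0n.
by rewrite natrD => h'; field.
Qed.

Lemma density_ge0 X Y Z : 0 <= density R E X Y Z.
Proof. by rewrite divr_ge0 ?ler0n. Qed.

Lemma density_le1 X Y Z : density R E X Y Z <= 1.
Proof.
have [h|] := posnP (#|X| * #|Y| * #|Z|)%N.
  by rewrite density_edge h invr0 mulr0 ler01.
move=> h; rewrite -subr_ge0 density_nonedge //.
by rewrite divr_ge0 ?ler0n.
Qed.

Lemma density_complete X Y Z : (0 < #|X| * #|Y| * #|Z|)%N ->
  (forall x y z, x \in X -> y \in Y -> z \in Z -> [set x; y; z] \in E) ->
  density R E X Y Z = 1.
Proof.
move=> h hE; apply/eqP; rewrite eq_sym -subr_eq0 density_nonedge //.
rewrite (_ : nonedge_triples X Y Z = set0) ?cards0 ?mul0r //.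
apply/setP => -[[x y] z]; rewrite !inE /=; apply/negP.
by case/andP=> /andP[/andP[hx hy] hz] /negP; apply; apply: hE.
Qed.

Lemma density_empty X Y Z :
  (forall x y z, x \in X -> y \in Y -> z \in Z -> [set x; y; z] \notin E) ->
  density R E X Y Z = 0.
Proof.
move=> hE; rewrite density_edge.
rewrite (_ : edge_triples X Y Z = set0) ?cards0 ?mul0r //.
apply/setP => -[[x y] z]; rewrite !inE /=; apply/negP.
by case/andP=> /andP[/andP[hx hy] hz]; apply/negP; apply: hE.
Qed.

(** Three of the four factors [eps] pay for shrinking the three sides: [b < eps^4 xyz = eps (eps
    x)(eps y)(eps z) <= eps x'y'z']. Plain counts let the same bound serve edges and non-edges. *)
Lemma ratio_subtriple (eps : R) (a b x y z x' y' z' : nat) :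
  0 < eps -> (a <= b)%N -> (0 < x * y * z)%N ->
  eps * x%:R <= x'%:R -> eps * y%:R <= y'%:R -> eps * z%:R <= z'%:R ->
  b%:R / (x * y * z)%:R < eps ^+ 4 -> a%:R / (x' * y' * z')%:R < eps.
Proof.
move=> e0 ab; rewrite !muln_gt0 => /andP[/andP[x0 y0] z0] hx hy hz.
have p0 (m : nat) : (0 < m)%N -> (0 : R) < m%:R by rewrite ltr0n.
have [ex ey ez] : [/\ 0 < eps * x%:R, 0 < eps * y%:R & 0 < eps * z%:R].
  by split; apply: mulr_gt0 => //; apply: p0.
rewrite ltr_pdivrMr ?ltr0n ?muln_gt0 ?x0 ?y0 // ltr_pdivrMr; last first.
  rewrite !natrM; apply: mulr_gt0; last exact: lt_le_trans hz.
  by apply: mulr_gt0; [exact: lt_le_trans hx | exact: lt_le_trans hy].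
move=> hb; apply: (@le_lt_trans _ _ b%:R); first by rewrite ler_nat.
apply: (lt_le_trans hb); rewrite !natrM.
have -> : eps ^+ 4 * (x%:R * y%:R * z%:R)
  = eps * ((eps * x%:R) * (eps * y%:R) * (eps * z%:R)) by ring.
rewrite ler_pM2l //; apply: ler_pM => //; [by apply/ltW/mulr_gt0 | exact: ltW |].
by apply: ler_pM => //; exact: ltW.
Qed.

Lemma homogeneous_regular (eps : R) X Y Z : 0 < eps ->
  X != set0 -> Y != set0 -> Z != set0 ->
  eps_homogeneous E (eps ^+ 4) X Y Z -> eps_regular E eps X Y Z.
Proof.
move=> e0; rewrite -!card_gt0 => X0 Y0 Z0 hom.
apply/forallP => X'; apply/forallP => Y'; apply/forallP => Z'; apply/implyP.
case/and5P=> sX sY sZ hx /andP[hy hz].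
have p0 : (0 < #|X| * #|Y| * #|Z|)%N by rewrite !muln_gt0 X0 Y0 Z0.
have gt0 (x x' : nat) : (0 < x)%N -> eps * x%:R <= x'%:R -> (0 < x')%N.
  by rewrite -!(ltr0n R) => x0; apply: lt_le_trans; rewrite mulr_gt0.
have p0' : (0 < #|X'| * #|Y'| * #|Z'|)%N.
  by rewrite !muln_gt0 (gt0 _ _ X0 hx) (gt0 _ _ Y0 hy) (gt0 _ _ Z0 hz).
(* Two densities in [[0, 1]] differ by at most 1, which settles [1 <= eps]. Below 1,
   [eps ^+ 4 <= eps] puts both densities within [eps] of the same end of [[0, 1]]. *)
have [e1|e1] := leP 1 eps.
  apply: le_trans e1.
  have := density_ge0 X Y Z; have := density_ge0 X' Y' Z'.
  have := density_le1 X Y Z; have := density_le1 X' Y' Z'.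
  by rewrite ler_norml; lra.
have e4 : eps ^+ 4 <= eps by rewrite exprS ler_piMr ?exprn_ile1 ?ltW.
have sub : setX (setX X' Y') Z' \subset setX (setX X Y) Z.
  by apply: setXS => //; apply: setXS.
case/orP: hom => hd.
  have : density R E X' Y' Z' < eps.
    apply: ratio_subtriple hd => //; apply: subset_leq_card.
    by apply/subsetP => t /setIdP[tb tE]; apply/setIdP; split=> //; apply: (subsetP sub).
  have := density_ge0 X Y Z; have := density_ge0 X' Y' Z'.
  by rewrite ler_norml; lra.
have {}hd : 1 - density R E X Y Z < eps ^+ 4 by lra.
have : 1 - density R E X' Y' Z' < eps.
  rewrite density_nonedge //; rewrite density_nonedge // in hd.
  apply: ratio_subtriple hd => //; apply: subset_leq_card.
  by apply/subsetP => t /setIdP[tb tE]; apply/setIdP; split=> //; apply: (subsetP sub).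
have := density_le1 X Y Z; have := density_le1 X' Y' Z'.
by rewrite ler_norml; lra.
Qed.

Lemma homogeneous_regular_partition (eps : R) (P : {set {set V}}) : 0 < eps ->
  homogeneous_partition E (eps ^+ 4) P -> regular_partition E eps P.
Proof.
move=> e0 /andP[pP hP]; rewrite /regular_partition /good_partition pP /=.
(* For [1 <= eps] the required number of triples is at most 0. *)
have [e1|e1] := leP 1 eps.
  by apply: (@le_trans _ _ 0); rewrite ?ler0n ?mulr_le0_ge0 ?ler0n ?subr_le0.
have e4 : eps ^+ 4 <= eps by rewrite exprS ler_piMr ?exprn_ile1 ?ltW.
apply: le_trans (_ : (1 - eps ^+ 4) * (#|V| ^ 3)%:R <= _).
  by rewrite ler_wpM2r ?ler0n // lerB.
apply: (le_trans hP); rewrite ler_nat; apply: subset_leq_card.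
have P0 X : X \in P -> X != set0.
  by case/and3P: pP => _ _ n0 XP; apply: contraNneq n0 => <-.
apply/subsetP => t; rewrite !inE => /existsP[X /andP[XP /existsP[Y /andP[YP]]]].
case/existsP=> Z /andP[ZP /and4P[tX tY tZ h]].
apply/existsP; exists X; rewrite XP; apply/existsP; exists Y; rewrite YP.
apply/existsP; exists Z; rewrite ZP tX tY tZ /=.
by apply: homogeneous_regular h => //; apply: P0.
Qed.

End Density.

(** * Large parts and large triples of parts *)

Lemma partition_large_part (V : finType) (P : {set {set V}}) (B : {set V}) (M : nat) :
  partition P [set: V] -> (#|P| <= M)%N -> (0 < #|B|)%N ->
  exists2 X, X \in P & (#|B| <= M * #|X :&: B|)%N.
Proof.
move=> pP PM B0.
have [/existsP[X /andP[XP hX]]|/existsPn h] :=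
  boolP [exists X in P, #|B| <= M * #|X :&: B|]%N; first by exists X.
have [b bB] : exists b, b \in B by apply/set0Pn; rewrite -card_gt0.
have P0 : (0 < #|P|)%N.
  have : b \in cover P by case/and3P: pP => /eqP-> _ _; rewrite inE.
  by case/bigcupP=> X XP _; rewrite card_gt0; apply/set0Pn; exists X.
have cB : #|B| = (\sum_(X in P) #|X :&: B|)%N.
  have := @set_partition_big_cond _ _ _ addn P setT (mem B) (fun=> 1%N) pP.
  rewrite (eq_bigl (mem B)) => [|x]; last by rewrite inE.
  rewrite sum1_card => ->; apply: eq_bigr => X XP.
  by rewrite sum1_card; apply: eq_card => x; rewrite !inE.
(* If every part failed, summing [M * #|X :&: B| < #|B|] over the at most [M] parts would give this;
   one part is split off to keep the inequality strict. *)
have : (M * #|B| < M * #|B|)%N.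
  rewrite {1}cB big_distrr /=.
  apply: (@leq_trans (\sum_(X in P) #|B|)%N); last first.
    by rewrite sum_nat_const leq_mul2r PM orbT.
  have [X XP] : exists X, X \in P by apply/set0Pn; rewrite -card_gt0.
  rewrite (bigD1 X) //= [X in (_ < X)%N](bigD1 X) //= -addSn leq_add //.
    by have := h X; rewrite XP /= -ltnNge.
  apply: leq_sum => Y /andP[YP _].
  by have := h Y; rewrite YP /= -ltnNge => /ltnW.
by rewrite ltnn.
Qed.

(** Each vertex lies in a single part, so an irregular triple of parts removes its whole product
    from the good triples, leaving fewer than [(1 - eps) |V|^3]. *)
Lemma big_triple_regular (R : realType) (V : finType) (F : {set {set V}}) (eps : R)
    (P : {set {set V}}) (X Y Z : {set V}) :
  regular_partition F eps P -> X \in P -> Y \in P -> Z \in P ->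
  eps * (#|V| ^ 3)%:R < (#|X| * #|Y| * #|Z|)%:R -> eps_regular F eps X Y Z.
Proof.
case/andP=> pP hP XP YP ZP big; apply: contraLR hP => nreg.
rewrite -ltNge.
set G := [set t | _].
have dis : [disjoint G & setX (setX X Y) Z].
  rewrite disjoint_subset; apply/subsetP => -[[x y] z]; rewrite !inE /=.
  case/existsP=> X' /andP[X'P /existsP[Y' /andP[Y'P /existsP[Z' /andP[Z'P]]]]].
  case/and4P=> xX' yY' zZ' reg; apply: contra nreg.
  case/andP=> /andP[xX yY] zZ.
  case/and3P: pP => _ tP _.
  by rewrite -(def_pblock tP XP xX) -(def_pblock tP YP yY) -(def_pblock tP ZP zZ)
    (def_pblock tP X'P xX') (def_pblock tP Y'P yY') (def_pblock tP Z'P zZ').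
have : (#|G| + #|X| * #|Y| * #|Z| <= #|V| ^ 3)%N.
  rewrite -!cardsX; have := leq_card_setU G (setX (setX X Y) Z).
  rewrite dis => -[_ /eqP <-]; apply: leq_trans (max_card _) _.
  by rewrite !card_prod !expnS expn0 muln1 mulnA.
rewrite -(ler_nat R) natrD; lra.
Qed.

(** * Regular partitions of blowups and separated vertices *)

(** The edge is at [x] and the non-edge at [y], hence the two orders in [separated]. The
    disequalities make the corresponding triples of a blowup meet three different fibers. *)
Definition separates (U : finType) (E : {set {set U}}) (x y : U) (z : U * U) : bool :=
  [&& z.1 != z.2, z.1 \notin [set x; y], z.2 \notin [set x; y],
      [set x; z.1; z.2] \in E & [set y; z.1; z.2] \notin E].

Definition separated (U : finType) (E : {set {set U}}) (S : {set U}) (x y : U) : bool :=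
  [exists z in setX S S, separates E x y z || separates E y x z].

Section PartialBlowup.
Variables (R : realType) (U W : finType) (E : {set {set U}}) (F : {set {set W}}).
Variables (S : {set U}) (p : W -> U) (n : nat).
Let fiber u := [set w | p w == u].
Hypothesis n_gt0 : (0 < n)%N.
Hypothesis pS : forall w, p w \in S.
Hypothesis card_fiber : forall u, u \in S -> #|fiber u| = n.
Hypothesis blowup : forall x1 x2 x3 : W,
  p x1 != p x2 -> p x1 != p x3 -> p x2 != p x3 ->
  ([set x1; x2; x3] \in F) = ([set p x1; p x2; p x3] \in E).

Lemma card_blowup : #|W| = (n * #|S|)%N.
Proof.
rewrite -[#|W|]sum1_card (partition_big p (mem S)) => [|w _]; last exact: pS.
rewrite (eq_bigr (fun=> n)) => [|u uS]; first by rewrite sum_nat_const mulnC.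
by rewrite sum1_card -(card_fiber uS); apply: eq_card => w; rewrite inE.
Qed.

(** The subtriples over [x] and over [y] have densities 1 and 0; a density within [eps] of both
    would force [1 <= 2 eps]. *)
Lemma separates_irregular (eps : R) (x y : U) (z : U * U) (X Y Z : {set W}) :
  eps < 2^-1 -> separates E x y z ->
  (0 < #|X :&: fiber x|)%N -> (0 < #|X :&: fiber y|)%N ->
  (0 < #|Y :&: fiber z.1|)%N -> (0 < #|Z :&: fiber z.2|)%N ->
  eps * #|X|%:R <= #|X :&: fiber x|%:R -> eps * #|X|%:R <= #|X :&: fiber y|%:R ->
  eps * #|Y|%:R <= #|Y :&: fiber z.1|%:R -> eps * #|Z|%:R <= #|Z :&: fiber z.2|%:R ->
  ~~ eps_regular F eps X Y Z.
Proof.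
case: z => z1 z2 eps2 /and5P[/= z12 z1xy z2xy xE yE] x0 y0 z10 z20 hx hy h1 h2.
move: z1xy z2xy; rewrite !inE !negb_or => /andP[z1x z1y] /andP[z2x z2y].
apply/negP => /forallP reg.
have d1 : density R F (X :&: fiber x) (Y :&: fiber z1) (Z :&: fiber z2) = 1.
  apply: density_complete => [|a b c]; first by rewrite !muln_gt0 x0 z10.
  rewrite !inE => /andP[_ /eqP ax] /andP[_ /eqP b1] /andP[_ /eqP c2].
  by rewrite blowup ?ax ?b1 ?c2 // eq_sym.
have d0 : density R F (X :&: fiber y) (Y :&: fiber z1) (Z :&: fiber z2) = 0.
  apply: density_empty => a b c.
  rewrite !inE => /andP[_ /eqP ay] /andP[_ /eqP b1] /andP[_ /eqP c2].
  by rewrite blowup ?ay ?b1 ?c2 // eq_sym.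
have := reg (X :&: fiber x) => /forallP/(_ (Y :&: fiber z1))/forallP/(_ (Z :&: fiber z2)).
have := reg (X :&: fiber y) => /forallP/(_ (Y :&: fiber z1))/forallP/(_ (Z :&: fiber z2)).
rewrite !subsetIl hx hy h1 h2 d0 d1 /= !ler_norml => /andP[_ h] /andP[h' _]; lra.
Qed.

Lemma separated_le_parts (A : {set U}) (M : nat) (eps : R) (P : {set {set W}}) :
  A \subset S -> {in A &, forall x y, x != y -> separated E S x y} ->
  0 < eps -> eps * ((M * #|S|) ^ 3)%:R < 1 -> eps < 2^-1 ->
  regular_partition F eps P -> (#|P| <= M)%N -> (#|A| <= M)%N.
Proof.
move=> AS sepA eps0 epsMS eps2 regP PM; rewrite leqNgt; apply/negP => MA.
have pP : partition P [set: W] by case/andP: regP.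
(* A part holding at least [n / M] vertices of the fiber; for [u] in [S] one exists, so the default
   [set0] is never taken there. *)
pose f u := odflt set0 [pick X in P | (n <= M * #|X :&: fiber u|)%N].
have fP u : u \in S -> f u \in P /\ (n <= M * #|f u :&: fiber u|)%N.
  move=> uS; rewrite /f; case: pickP => [X /andP[//]|/= none].
  have [|X XP] := partition_large_part pP PM (B := fiber u); first by rewrite card_fiber.
  by rewrite card_fiber // => h; have := none X; rewrite XP h.
have [x xA [y /[!inE] /andP[xy yA] fxy]] :
    exists2 x, x \in A & exists2 y, y \in [predD1 A & x] & f x = f y.
  apply/dinjectivePn/negP => /dinjectiveP finj.
  move: MA; rewrite ltnNge -(card_in_imset finj) => /negP; apply.
  apply: leq_trans PM; apply/subset_leq_card/subsetP => _ /imsetP[u uA ->].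
  by case: (fP u (subsetP AS u uA)).
have xS := subsetP AS x xA; have yS := subsetP AS y yA.
have S0 : (0 < #|S|)%N by rewrite card_gt0; apply/set0Pn; exists x.
have M0 : (0 < M)%N by case: (fP x xS) => _; case: (M) n_gt0 => //; case: (n).
have pos u : u \in S -> (0 < #|f u :&: fiber u|)%N.
  by move=> /fP[_]; case: #|_| => //; rewrite muln0 leqNgt n_gt0.
(* The cubic bound makes the triples of parts regular; this linear consequence makes the fiber
   pieces large relative to their parts. *)
have epsMS1 : eps * (M * #|S|)%:R < 1.
  apply: le_lt_trans epsMS; rewrite ler_pM2l // ler_nat -[leqLHS]expn1.
  by rewrite leq_pexp2l // muln_gt0 M0.
(* A part has at most [|W| = n |S|] vertices, that is, at most [M |S|] times its piece of the
   fiber. *)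
have large u : u \in S -> eps * #|f u|%:R <= #|f u :&: fiber u|%:R.
  move=> uS; have [_ hu] := fP u uS.
  have : (#|f u| <= (M * #|S|) * #|f u :&: fiber u|)%N.
    apply: leq_trans (max_card _) _; rewrite card_blowup mulnAC leq_mul2r.
    by rewrite hu orbT.
  rewrite -(ler_nat R) -(ler_pM2l eps0) => /le_trans; apply.
  by rewrite natrM mulrA ler_piMl ?ler0n ?ltW.
(* The three parts have product at least [(n / M)^3], which exceeds [eps (n |S|)^3 = eps |W|^3]. *)
have reg u v w : u \in S -> v \in S -> w \in S -> eps_regular F eps (f u) (f v) (f w).
  move=> uS vS wS; have [[uP _] [vP _]] := (fP u uS, fP v vS); have [wP _] := fP w wS.
  apply: big_triple_regular regP _ _ _ _ => //.
  have le1 a : a \in S -> (n <= M * #|f a|)%N.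
    by move=> /fP[_ /leq_trans]; apply; rewrite leq_mul2l subset_leq_card ?subsetIl ?orbT.
  have : (n ^ 3 <= M ^ 3 * (#|f u| * #|f v| * #|f w|))%N.
    rewrite (_ : M ^ 3 * _ = M * #|f u| * (M * #|f v|) * (M * #|f w|))%N; last by ring.
    by rewrite (_ : n ^ 3 = n * n * n)%N; [rewrite !leq_mul ?le1 | ring].
  rewrite -(ler_nat R) natrM => hn.
  have M3 : 0 < (M ^ 3)%:R :> R by rewrite ltr0n expn_gt0 M0.
  rewrite -(ltr_pM2l M3); apply: lt_le_trans hn.
  rewrite card_blowup mulrCA -natrM -expnMn mulnCA expnMn natrM mulrCA.
  by rewrite gtr_pMr // ltr0n expn_gt0 n_gt0.
have irr a b z : a \in A -> b \in A -> f a = f b -> z \in setX S S ->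
    separates E a b z -> False.
  move=> aA bA fab; case: z => z1 z2 /setXP[z1S z2S] sep.
  have aS := subsetP AS a aA; have bS := subsetP AS b bA.
  have [posb largeb] : (0 < #|f a :&: fiber b|)%N /\
      eps * #|f a|%:R <= #|f a :&: fiber b|%:R.
    by rewrite fab; split; [apply: pos | apply: large].
  have /negP := separates_irregular eps2 sep (pos a aS) posb (pos z1 z1S) (pos z2 z2S)
    (large a aS) largeb (large z1 z1S) (large z2 z2S).
  by apply; apply: reg.
have /existsP[z /andP[zS]] := sepA x y xA yA (contra_neq (@esym _ _ _) xy).
by case/orP; apply: irr.
Qed.

End PartialBlowup.

(** * Separating sets in irreducible 3-graphs *)

Section Separators.
Variables (U : finType) (E : {set {set U}}).
Hypothesis uniE : uniform3 E.

Lemma not_simG_separates (x y : U) :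
  ~~ simG E x y -> exists z, separates E x y z || separates E y x z.
Proof.
case/forallPn => z1 /forallPn[z2]; rewrite negb_imply => /andP[/andP[h1 h2] ne].
exists (z1, z2); rewrite /separates /= ![[set y; x]]setUC h1 h2 /=.
have -> : z1 != z2.
  apply: contraNneq ne => <-.
  (* With [z1 = z2] both sets have at most two elements, so neither is an edge and [x], [y] could
     not differ on them. *)
  have deg u : [set u; z1; z1] \in E = false.
    apply/negP => /(forall_inP uniE); rewrite -setUA setUid cards2.
    by case: (_ != _).
  by rewrite !deg.
by move: ne; do 2!case: (_ \in E).
Qed.

Lemma small_separating_set (A : {set U}) : {in A &, forall x y, x != y -> ~~ simG E x y} ->
  exists S : {set U}, [/\ A \subset S, (#|S| <= #|A| + 2 * #|A| ^ 2)%N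
    & {in A &, forall x y, x != y -> separated E S x y}].
Proof.
move=> nsim.
(* The default [a], taken for instance on the diagonal, contributes only vertices of [A]. *)
pose d (a : U * U) := odflt a [pick z | separates E a.1 a.2 z || separates E a.2 a.1 z].
exists (A :|: ([set (d a).1 | a in setX A A] :|: [set (d a).2 | a in setX A A])).
split; first exact: subsetUl.
  have cU (B C : {set U}) : (#|B :|: C| <= #|B| + #|C|)%N by rewrite leq_card_setU.
  apply: leq_trans (cU _ _) _; rewrite leq_add2l; apply: leq_trans (cU _ _) _.
  by rewrite mul2n -addnn -mulnn -cardsX leq_add ?leq_imset_card.
move=> x y xA yA /(nsim x y xA yA) /not_simG_separates[z hz].
have aA : (x, y) \in setX A A by rewrite in_setX xA.
apply/existsP; exists (d (x, y)); apply/andP; split; last first.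
  by rewrite /d; case: pickP => [//|/(_ z)]; rewrite hz.
rewrite [d _]surjective_pairing in_setX !in_setU.
by rewrite (imset_f (fun a => (d a).1) aA) (imset_f (fun a => (d a).2) aA) !orbT.
Qed.

(** The classes of a maximal set of pairwise inequivalent vertices cover [U], with at most two
    vertices each. Exactly [k] of its vertices are kept because the size of the separating set grows
    with [A]. *)
Lemma irreducible_nonsim_set (k : nat) : irreducible3 E -> (2 * k <= #|U|)%N ->
  exists2 A : {set U}, #|A| = k & {in A &, forall x y, x != y -> ~~ simG E x y}.
Proof.
move=> irrE kU.
have simC x y : simG E x y -> simG E y x.
  move=> /forallP h; apply/forallP => z1; apply/forallP => z2.
  by have /forallP/(_ z2) := h z1; rewrite [[set y; x]]setUC eq_sym.
have simxx x : simG E x x by apply/forallP => z1; apply/forallP => z2; rewrite eqxx implybT.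
pose free (A : {set U}) := [forall x in A, forall y in A, (x != y) ==> ~~ simG E x y].
have freeP (A : {set U}) : reflect {in A &, forall x y, x != y -> ~~ simG E x y} (free A).
  apply: (iffP forall_inP) => h x.
    by move=> y xA yA; have /forall_inP/(_ y yA)/implyP := h x xA.
  by move=> xA; apply/forall_inP => y yA; apply/implyP; apply: h.
have [A /maxsetP[/freeP fA maxA]] : {A | maxset free A}.
  by apply: ex_maxset; exists set0; apply/freeP => x; rewrite inE.
have cover : [set: U] \subset \bigcup_(a in A) [set y | simG E a y].
  apply/subsetP => y _; apply/bigcupP.
  have [yA|yA] := boolP (y \in A); first by exists y; rewrite ?inE.
  have [/existsP[a /andP[aA ay]]|/existsPn none] := boolP [exists a in A, simG E a y].
    by exists a; rewrite ?inE.
  case/negP: yA; rewrite -(maxA (y |: A)) ?setU11 ?subsetUr //.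
  have no a : a \in A -> ~~ simG E a y by move=> aA; have := none a; rewrite aA.
  apply/freeP => a b; rewrite !inE => /orP[/eqP->|aA] /orP[/eqP->|bA]; rewrite ?eqxx //.
  - by move=> _; apply/negP => /simC; apply/negP/no.
  - by move=> _; apply: no.
  - exact: fA.
have kA : (k <= #|A|)%N.
  rewrite -(leq_pmul2l (isT : 0 < 2)%N) (leq_trans kU) // -cardsT.
  apply: leq_trans (subset_leq_card cover) _.
  have -> : (2 * #|A| = \sum_(a in A) 2)%N by rewrite sum_nat_const mulnC.
  elim/big_rec2: _ => [|a m B _ IH]; first by rewrite cards0.
  apply: leq_trans (leq_card_setU _ _) _; apply: leq_add => //.
  by have /forallP/(_ a)/orP[/eqP->|/eqP->] := irrE.
have /card_geqP[s [us ss sA]] := kA.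
exists [set x in s]; first by rewrite cardsE (card_uniqP us).
by move=> x y; rewrite !inE => /sA xA /sA yA; apply: fA.
Qed.

End Separators.

(** * Large irreducible 3-graphs with blowups in the property *)

Lemma B_infinite_large (H : prop3) (m : nat) : B_infinite H ->
  exists (U : finType) (E : {set {set U}}), inB H E /\ (m <= #|U|)%N.
Proof.
move=> Binf; case: m => [|m].
  by have [Vs [Es [BEs _]]] := Binf 1%N; exists (Vs ord0), (Es ord0); split.
have [Vs [Es [BEs noniso]]] := Binf #|{: 'I_m.+1 * {set {set 'I_m.+1}}}|.+1.
have [/existsP[i mi]|/existsPn small] := boolP [exists i, m < #|Vs i|]%N.
  by exists (Vs i), (Es i); split.
have {}small i : (#|Vs i| <= m)%N by rewrite leqNgt small.
pose emb i (v : Vs i) : 'I_m.+1 := inord (enum_rank v).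
have embE i v : @emb i v = enum_rank v :> nat.
  by rewrite inordK // (leq_trans (ltn_ord _)) // (leq_trans (small i)).
have emb_inj i : injective (@emb i).
  by move=> u v /(congr1 val) /=; rewrite !embE => /val_inj /enum_rank_inj.
(* A copy of the 3-graph on an initial segment of ['I_m.+1]. The vertex count, at most [m], is
   recorded because edges do not detect isolated vertices; equal codes give isomorphic 3-graphs. *)
pose code i := (inord #|Vs i| : 'I_m.+1, img_edges (@emb i) (Es i)).
have [i [j ij [cardij edgeij]]] : exists i, exists2 j, i != j & code i = code j.
  apply/injectivePn; apply/negP => /injectiveP /leq_card.
  by rewrite card_ord ltnn.
have {}cardij : #|Vs i| = #|Vs j|.
  by move/(congr1 val): cardij; rewrite /= !inordK ?ltnS.
case: (noniso i j ij).
pose g (v : Vs i) : Vs j := enum_val (cast_ord cardij (enum_rank v)).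
have embg v : emb j (g v) = emb i v by apply: val_inj; rewrite /= !embE enum_valK.
exists g; split.
  apply: inj_card_bij; last by rewrite cardij.
  by move=> u v /(congr1 (@emb j)); rewrite !embg => /emb_inj.
move=> e; rewrite -(mem_imset _ _ (imset_inj (@emb_inj j))).
rewrite -[RHS](mem_imset _ _ (imset_inj (@emb_inj i))).
rewrite -/(img_edges _ (Es i)) edgeij -imset_comp /img_edges.
by rewrite (eq_imset _ (embg : @emb j \o g =1 @emb i)).
Qed.

(** * The lower bound on the number of parts *)

Lemma card_set3 (T : finType) (x y z : T) :
  x != y -> x != z -> y != z -> #|[set x; y; z]| = 3.
Proof. by move=> xy xz yz; rewrite -setUA cardsU1 cards2 !inE negb_or xy xz yz. Qed.

Lemma reg_bound_ge (R : realType) (H : prop3) (eps : R) (k M : nat) :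
  hereditary H -> B_infinite H -> 0 < eps -> (1 < k)%N ->
  eps * ((k * (k + 2 * k ^ 2)) ^ 3)%:R < 1 -> reg_bound H eps M -> (k <= M)%N.
Proof.
move=> [uniH _ indH] /(@B_infinite_large H (2 * k))[U [E [[uniE irrE blowE] kU]]].
move=> eps0 k1 epsk [N hN]; rewrite leqNgt; apply/negP => Mk.
have [A cA nsim] := irreducible_nonsim_set irrE kU.
have [S [AS cS sepA]] := small_separating_set uniE nsim.
have S0 : (0 < #|S|)%N by apply: leq_trans (subset_leq_card AS); rewrite cA ltnW.
(* Fibers of size [N.+1] are nonempty, and even a single one has the [N] vertices that the bound
   requires. *)
have [W [F [[p [cp blowp]] HF]]] := blowE N.+1 isT.
(* Heredity is applied to the blowup, not to [E]: only the fibers over [S] are kept, and [q] still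
   takes values in [U]. *)
pose T := p @^-1: S.
pose q (w : {x | x \in T}) := p (val w).
have qS w : q w \in S by have := valP w; rewrite inE.
have cq u : u \in S -> #|[set w | q w == u]| = N.+1.
  move=> uS; rewrite -(card_imset _ val_inj) -(cp u); apply: eq_card => w.
  rewrite inE; apply/imsetP/eqP => [[v /[!inE] /eqP <- ->] //|pw].
  have wT : w \in T by rewrite inE pw.
  by exists (Sub w wT) => //; rewrite inE /q /= pw.
have blowq x1 x2 x3 : q x1 != q x2 -> q x1 != q x3 -> q x2 != q x3 ->
    ([set x1; x2; x3] \in induced F T) = ([set q x1; q x2; q x3] \in E).
  move=> n12 n13 n23; rewrite -blowp // inE !imsetU !imset_set1.
  by rewrite card_set3 ?eqxx //; [move: n12 | move: n13 | move: n23];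
    apply: contra_neq => ->.
have [|P [regP PM]] := hN _ _ (indH _ _ T HF).
  by rewrite (card_blowup qS cq) (leq_trans (leqnSn N)) // leq_pmulr.
(* This lets the bound on [eps] times the cube also yield [eps < 1/2]. *)
have k3 : (2 <= (k * (k + 2 * k ^ 2)) ^ 3)%N.
  rewrite (leq_trans k1) // -[leqLHS]expn1 -[leqLHS]muln1 expnMn.
  by rewrite leq_mul ?leq_pexp2l ?expn_gt0 //; lia.
have eps2 : eps < 2^-1.
  rewrite -[ltRHS]mul1r ltr_pdivlMr ?ltr0n //; apply: le_lt_trans epsk.
  by rewrite ler_pM2l // ler_nat.
have epsM : eps * ((M * #|S|) ^ 3)%:R < 1.
  apply: le_lt_trans epsk; rewrite ler_pM2l // ler_nat leq_exp2r //.
  by apply: leq_mul; [exact: ltnW | rewrite -cA].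
have := separated_le_parts (isT : 0 < N.+1)%N qS cq blowq AS sepA eps0 epsM eps2 regP PM.
by rewrite cA leqNgt Mk.
Qed.

Theorem theorem7p5 (R : realType) (H : prop3) :
  hereditary H -> B_infinite H ->
  (exists C : R, 0 < C /\
     exists eps0 : R, 0 < eps0 /\
       forall eps : R, 0 < eps -> eps < eps0 ->
         forall M : nat, is_MH H eps M -> powR eps (- C) <= M%:R)
  /\
  (MHhom_defined R H ->
     forall eps : R, 0 < eps ->
       forall M Mh : nat, is_MH H eps M -> is_MHhom H (eps ^+ 4) Mh -> (M <= Mh)%N).
Proof.
move=> herH Binf; split; last first.
  move=> _ eps eps0 M Mh [_ minM] [[N hN] _]; apply: minM; exists N => V E HE NV.
  have [P [homP PM]] := hN V E HE NV.
  by exists P; split=> //; apply: homogeneous_regular_partition homP.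
(* With [k <= 2t], the cube is at most [27 k^9 <= 27 (2t)^9 = c t^9]. *)
pose c : R := 3 ^+ 3 * 2 ^+ 9.
have c1 : 1 <= c by rewrite -[1]mulr1 ler_pM ?exprn_ege1 // ler1n.
have c0 : 0 < c by apply: lt_le_trans c1.
(* The exponent gives [eps^-1 = t^10], one power of [t] above [c t^9]; the threshold [c ^- 10] makes
   [c < t], so that this power absorbs [c]. *)
exists 10^-1; split; first by rewrite invr_gt0 ltr0n.
exists (c ^- 10); split; first by rewrite invr_gt0 exprn_gt0.
move=> eps eps0 epsc M [hM _].
set t := powR eps _.
have t0 : 0 < t by apply: powR_gt0.
have t10 : t ^+ 10 = eps^-1.
  rewrite -powR_mulrn ?ltW // -powRrM -[RHS]powR_inv1 ?ltW //; congr powR.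
  by rewrite mulNr mulVf // pnatr_eq0.
have ct : c < t.
  rewrite -(@ltr_pXn2r _ 10) ?nnegrE ?ltW // t10.
  by rewrite -[ltLHS]invrK ltf_pV2 // posrE ?invr_gt0 ?exprn_gt0.
have t1 : 1 < t by apply: le_lt_trans ct.
have /andP[kt tk] := truncn_itv (ltW t0).
(* The successor makes [t < k], so [k <= M] suffices; [k <= t + 1 <= 2t] since [1 < t]. *)
set k := (Num.truncn t).+1 in tk.
apply: ltW; apply: (lt_le_trans tk); rewrite ler_nat.
apply: reg_bound_ge hM => //.
  by rewrite -(ltr_nat R); apply: lt_trans tk.
have k2t : k%:R <= 2 * t by rewrite /k -natr1; lra.
have et : eps * t ^+ 10 = 1 by rewrite t10 mulfV // gt_eqF.
rewrite -[ltRHS]et ltr_pM2l //.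
apply: (@le_lt_trans _ _ (c * t ^+ 9)); last first.
  by rewrite [ltRHS]exprS ltr_pM2r // exprn_gt0.
have : ((k * (k + 2 * k ^ 2)) ^ 3 <= 3 ^ 3 * k ^ 9)%N.
  rewrite (_ : 3 ^ 3 * k ^ 9 = (k * (k ^ 2 + 2 * k ^ 2)) ^ 3)%N; last by ring.
  by rewrite leq_exp2r // leq_mul2l leq_add2r -[leqLHS]expn1 leq_pexp2l ?orbT.
rewrite -(ler_nat R) => /le_trans; apply.
rewrite natrM !natrX /c -mulrA ler_pM2l ?exprn_gt0 ?ltr0n // -exprMn.
by rewrite lerXn2r // nnegrE ?mulr_ge0 ?ltW.
Qed.
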